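(* Let $w_1,w_2,\ldots$ be the Walsh functions on $[0,1]$ (in the Paley numeration). For every $p\in[1,2)$ there exists $\delta=\delta(p)>0$ such that for all sufficiently large $n$ (depending on $p$) the inequality $$d_{n^{1-\delta}}(\{w_1,\ldots,w_n\},L_p[0,1])\le n^{-\delta}$$ holds.
   Context: Kolmogorov width: for a normed space $X$, a subset $W\subset X$ and a real $m\ge 0$, $$d_m(W,X):=\inf_{\dim Q_m\le m}\ \sup_{x\in W}\ \rho(x,Q_m)_X,\qquad \rho(x,Q)_X:=\inf_{y\in Q}\|x-y\|_X,$$ where the infimum is over linear subspaces $Q_m\subset X$ of dimension at most $m$. Rademacher functions: $r_k\left(\sum_{j\ge1}2^{-j}x_j\right)=(-1)^{x_k}$, $k=1,2,\ldots$, where $x_j\in\{0,1\}$ are binary digits (defined almost everywhere on $[0,1]$). Walsh functions in the Paley numeration: if $n-1=\sum_{i\ge0}\epsilon_i2^i$ with $\epsilon_i\in\{0,1\}$ is the binary expansion of $n-1$, then $w_n=\prod_{i\ge0}r_{i+1}^{\epsilon_i}$, for $n=1,2,\ldots$ (so $w_1\equiv1$). *)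

(* Defs.v *)
From HB Require Import structures.
From mathcomp Require Import all_boot all_order all_algebra.
From mathcomp Require Import all_classical all_reals all_analysis.
From mathcomp Require Import measurable_realfun ess_sup_inf.

Set Implicit Arguments.
Unset Strict Implicit.
Unset Printing Implicit Defensive.

Import Order.TTheory GRing.Theory Num.Def Num.Theory.
Import numFieldNormedType.Exports.

Local Open Scope classical_set_scope.
Local Open Scope ring_scope.

Lemma ae_eq_Lnorm d (T : measurableType d) (R : realType)
    (mu : {measure set T -> \bar R}) (p : \bar R) (f g : {mfun T >-> R}) :
  (1 <= p)%E -> (f : T -> R) = (g : T -> R) %[ae mu] ->
  ('N[mu]_p[EFin \o (f : T -> R)] = 'N[mu]_p[EFin \o (g : T -> R)])%E.
Proof.
rewrite unlock /Lnorm; case: p => [r r1|_|//] fg.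
  have mp (h : {mfun T >-> R}) :
      measurable_fun [set: T] (fun x => `|(EFin \o h) x| `^ r)%E.
    apply: (@measurableT_comp _ _ _ _ _ _ (fun x => x `^ r)%E).
      exact: measurable_poweR.
    by apply: measurableT_comp => //; apply/measurable_EFinP.
  congr (_ `^ _)%E; apply: ae_eq_integral => //; try exact: mp.
  by apply: filterS fg => x fgx Dx /=; rewrite fgx.
case: ifPn => // _; apply: eq_ess_sup.
by apply: filterS fg => x fgx /=; rewrite fgx.
Qed.

(* MathComp-Analysis provides L_p only as a vector space of functions
   (LfunType); the normed space is its quotient by the subspace of functions
   vanishing almost everywhere. *)
Section Lp_space.
Context d (T : measurableType d) (R : realType).
Variables (mu : {measure set T -> \bar R}) (p : \bar R) (p1 : (1 <= p)%E).
Local Notation fT := (LfunType mu p1).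
Local Open Scope quotient_scope.

Definition null_Lfun : {pred fT} :=
  [pred f : fT | `[< (f : T -> R) = (cst 0 : T -> R) %[ae mu] >]].

Lemma null_LfunP (f : fT) :
  reflect ((f : T -> R) = (cst 0 : T -> R) %[ae mu]) (f \in null_Lfun).
Proof. exact: asboolP. Qed.

Lemma null_Lfun_zmod_closed : zmod_closed null_Lfun.
Proof.
split; first by apply/null_LfunP; exact: ae_eq_refl.
move=> f g /null_LfunP f0 /null_LfunP g0; apply/null_LfunP.
apply: filterS2 f0 g0 => x fx0 gx0 Dx.
by rewrite -[LHS]/(f x - g x) fx0// gx0// subr0.
Qed.

HB.instance Definition _ := GRing.isZmodClosed.Build fT null_Lfun
  null_Lfun_zmod_closed.

Lemma null_LfunZ (a : R) (f : fT) : f \in null_Lfun -> a *: f \in null_Lfun.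
Proof.
move=> /null_LfunP f0; apply/null_LfunP.
apply: filterS f0 => x fx0 Dx.
by rewrite -[LHS]/(a * f x) fx0// mulr0.
Qed.

Definition Lp : Type := Quotient.quot null_Lfun.

HB.instance Definition _ := GRing.Zmodule.on Lp.
HB.instance Definition _ := EqQuotient.on Lp.

Definition Lp_class (f : fT) : Lp := \pi_Lp f.

Lemma Lp_classP (f g : fT) :
  Lp_class f = Lp_class g <-> (f : T -> R) = (g : T -> R) %[ae mu].
Proof.
split=> [/eqP|fg].
  rewrite -Quotient.idealrBE => /null_LfunP; apply: filterS => x fgx Dx.
  by apply/eqP; rewrite -subr_eq0 -[_ - _]/((f - g : fT) x) fgx.
apply/eqP; rewrite -Quotient.idealrBE; apply/null_LfunP.
apply: filterS fg => x fgx Dx.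
by rewrite -[LHS]/(f x - g x) fgx// subrr.
Qed.

Lemma Lp_class_surj (u : Lp) : exists f, u = Lp_class f.
Proof. by exists (repr u); rewrite /Lp_class reprK. Qed.

Lemma Lp_classD f g : Lp_class (f + g) = Lp_class f + Lp_class g.
Proof. exact: Quotient.pi_add. Qed.

Let Lp_eq (f g : fT) : f - g \in null_Lfun -> Lp_class f = Lp_class g.
Proof. by move=> fg; apply/eqP; rewrite -Quotient.idealrBE. Qed.

Let Lp_class_repr (f : fT) : f - repr (Lp_class f) \in null_Lfun.
Proof. by rewrite Quotient.idealrBE reprK. Qed.

Definition Lp_scale (a : R) (u : Lp) : Lp := Lp_class (a *: repr u).

Lemma Lp_classZ a f : Lp_class (a *: f) = Lp_scale a (Lp_class f).
Proof. by apply: Lp_eq; rewrite -scalerBr null_LfunZ. Qed.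

Let scaleA a b v : Lp_scale a (Lp_scale b v) = Lp_scale (a * b) v.
Proof. by have [f ->] := Lp_class_surj v; rewrite -!Lp_classZ scalerA. Qed.

Let scale1 : left_id 1 Lp_scale.
Proof.
move=> v; have [f ->] := Lp_class_surj v.
by rewrite -Lp_classZ scale1r.
Qed.

Let scaleDr : right_distributive Lp_scale +%R.
Proof.
move=> a u v; have [f ->] := Lp_class_surj u; have [g ->] := Lp_class_surj v.
by rewrite -Lp_classD -!Lp_classZ scalerDr Lp_classD.
Qed.

Let scaleDl v : {morph Lp_scale^~ v : a b / a + b}.
Proof.
move=> a b; have [f ->] := Lp_class_surj v.
by rewrite -!Lp_classZ scalerDl Lp_classD.
Qed.

HB.instance Definition _ :=
  GRing.Zmodule_isLmodule.Build R Lp scaleA scale1 scaleDr scaleDl.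

Definition Lp_norm (u : Lp) : R := fine ('N[mu]_p[EFin \o (repr u : T -> R)])%E.

Lemma Lp_norm_class f :
  Lp_norm (Lp_class f) = fine ('N[mu]_p[EFin \o (f : T -> R)])%E.
Proof.
have fE : ('N[mu]_p[EFin \o (repr (Lp_class f) : T -> R)] =
           'N[mu]_p[EFin \o (f : T -> R)])%E.
  have /Lp_classP fg : Lp_class (repr (Lp_class f)) = Lp_class f.
    by rewrite /Lp_class reprK.
  by apply: ae_eq_Lnorm.
by rewrite /Lp_norm fE.
Qed.

Let norm_ler u v : Lp_norm (u + v) <= Lp_norm u + Lp_norm v.
Proof.
have [f ->] := Lp_class_surj u; have [g ->] := Lp_class_surj v.
by rewrite -Lp_classD !Lp_norm_class; exact: ler_LnormD.
Qed.

Let normZ a u : Lp_norm (a *: u) = `|a| * Lp_norm u.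
Proof.
have [f ->] := Lp_class_surj u.
rewrite -[_ *: _]/(Lp_scale _ _) -Lp_classZ !Lp_norm_class.
by rewrite [X in fine X]LnormZ -finite_norm_fine.
Qed.

Let norm0 u : Lp_norm u = 0 -> u = 0.
Proof.
have [f ->] := Lp_class_surj u.
rewrite Lp_norm_class => /fine_Lnormr_eq0 f0.
have -> : 0 = Lp_class 0.
  by rewrite -[0]/(Quotient.zero null_Lfun) /Quotient.zero; unlock.
by apply/Lp_classP; exact: f0.
Qed.

HB.instance Definition _ := @Lmodule_isNormed.Build R Lp Lp_norm
  norm_ler normZ norm0.

Lemma Lp_normE (f : fT) :
  `|Lp_class f| = fine ('N[mu]_p[EFin \o (f : T -> R)])%E.
Proof. exact: Lp_norm_class. Qed.

End Lp_space.

Section Kolmogorov_width.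
Context (R : realType) (X : normedModType R).

Definition linear_subspace (Q : set X) : Prop :=
  Q 0 /\ forall (a : R) (u v : X), Q u -> Q v -> Q (a *: u + v).

Definition is_basis (k : nat) (e : 'I_k -> X) (Q : set X) : Prop :=
  (forall c : 'I_k -> R, \sum_(i < k) c i *: e i = 0 -> forall i, c i = 0) /\
  Q = [set \sum_(i < k) c i *: e i | c in [set: 'I_k -> R]].

Definition subspace_dim_le (m : R) (Q : set X) : Prop :=
  linear_subspace Q /\
  exists (k : nat) (e : 'I_k -> X), is_basis e Q /\ k%:R <= m.

Definition dist_to (x : X) (Q : set X) : \bar R :=
  ereal_inf [set `|x - y|%:E | y in Q].

Definition kolmogorov_width (m : R) (W : set X) : \bar R :=
  ereal_inf [set ereal_sup [set dist_to x Q | x in W] | Q in subspace_dim_le m].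

End Kolmogorov_width.

Section Walsh.
Context {R : realType}.

(* The k-th binary digit of x in [0, 1[ is the parity of the integral part of
   2^k x; for dyadic rationals this selects the finite expansion. *)
Definition binary_digit (k : nat) (x : R) : bool := odd (truncn (2 ^+ k * x)).

Definition rademacher (k : nat) (x : R) : R := (-1) ^+ binary_digit k x.

(* The bits of n - 1 < 2 ^ n of index i >= n vanish, so the product over all i
   reduces to i < n. *)
Definition walsh (n : nat) (x : R) : R :=
  \prod_(i < n) rademacher i.+1 x ^+ odd (n.-1 %/ 2 ^ i).

(* Lebesgue measure of [0, 1] carried by the whole line: functions equal almost
   everywhere on [0, 1] are identified, whatever their values outside. *)
Definition leb01 : set (measurableTypeR R) -> \bar R :=
  mrestr (@lebesgue_measure R) (measurable_itv `[0, 1]).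

HB.instance Definition _ := Measure.on leb01.

Let leb01_fin : fin_num_fun leb01.
Proof.
move=> A mA; rewrite ge0_fin_numE ?measure_ge0//.
apply: (@le_lt_trans _ _ (@lebesgue_measure R `[0, 1])).
  by rewrite /leb01 /mrestr le_measure ?inE//=; exact: measurableI.
by rewrite lebesgue_measure_itv/= lte_fin ltr01 -EFinB ltry.
Qed.

HB.instance Definition _ := @Measure_isFinite.Build _ _ _ leb01 leb01_fin.

Lemma measurable_rademacher k : measurable_fun [set: R] (rademacher k).
Proof.
have mt : measurable_fun [set: R] (fun x : R => (truncn (2 ^+ k * x))%:R : R).
  apply: nondecreasing_measurable => // x y xy.
  by rewrite ler_nat le_truncn// ler_wpM2l// exprn_ge0.
have mc : measurable_fun [set: R] (fun y : R => cos (y * pi)).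
  apply: (measurableT_comp (f := cos)).
    by apply: continuous_measurable_fun => x; exact: continuous_cos.
  exact: measurable_funM.
rewrite (_ : rademacher k = (fun y : R => cos (y * pi)) \o
  (fun x : R => (truncn (2 ^+ k * x))%:R)); first exact: measurableT_comp.
apply/funext => x /=; rewrite /rademacher /binary_digit signr_odd.
elim: truncn => [|m IHm]; first by rewrite mul0r cos0.
by rewrite -natr1 mulrDl mul1r cosDpi -IHm exprS mulN1r.
Qed.

Lemma measurable_walsh n : measurable_fun [set: R] (walsh n).
Proof.
apply: measurable_prod => i _ /=; apply: measurable_funX.
exact: measurable_rademacher.
Qed.

Lemma normr_walsh n x : `|walsh n x| = 1.
Proof.
by rewrite normr_prod big1// => i _; rewrite !normrX normrN1 !expr1n.
Qed.

End Walsh.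

Lemma lee1_EFin (R : realType) (p : R) : 1 <= p -> (1 <= p%:E)%E.
Proof. by rewrite lee_fin. Qed.

Section Walsh_Lp.
Context {R : realType} (p : R) (p1 : 1 <= p).

Lemma walsh_Lfun (n : nat) :
  (walsh n : measurableTypeR R -> R) \in Lfun leb01 p%:E.
Proof.
have := Lfun_cst leb01 1 p; rewrite !inE => /andP[_]; rewrite !inE => c1.
apply/andP; split; rewrite inE; first exact: measurable_walsh.
rewrite /= /finite_norm -Lnorm_abse (eq_Lnorm _ _ (g := EFin \o cst 1)) // => x.
by rewrite /= normr_walsh.
Qed.

Definition L01 : normedModType R := Lp leb01 (lee1_EFin p1).

Definition walsh_L01 (n : nat) : L01 :=
  Lp_class (Lfun_Sub (lee1_EFin p1) (walsh_Lfun n)).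

End Walsh_Lp.

(* Main.v *)
Require Import Defs.
From mathcomp Require Import all_boot all_order all_algebra.
From mathcomp Require Import all_classical all_reals all_analysis.
From mathcomp Require Import measurable_realfun.
From mathcomp Require Import ring lra zify.

(** The Walsh functions w_1, ..., w_N with N = 2^k are the characters
    (-1)^|X :&: V| of the cube of subsets of a k-element set, evaluated at the
    set V of binary digits equal to 1 of the variable (walshE); each value of
    V is taken on a set of measure at most 1/N (leb01_cylinder).  So the
    matrix H(X, V) = (-1)^|X :&: V| has to be approximated by a matrix of rank
    N^(1-delta) whose error rows are small in the normalized l_p norm.  This
    is the failure of rigidity of Walsh-Hadamard matrices, with control of the
    size of the errors.

    Take k = 2Le with L a large constant.  By a Chernoff bound all but
    N^(1-delta) of the sets have a size between (L-1)e and (L+1)e; rows and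
    columns outside these middle layers are put into the low-rank part as they
    are.  For X and V in the middle layers |X :&: V| <= (L+1)e, so a
    polynomial P of degree D = (L-1)e with P(j) = (-1)^j on the D+1 integers
    2e <= j <= (L+1)e agrees with H unless |X :&: V| < 2e.  Expanding P in the
    binomial coefficients C(j, i), the matrix P(|X :&: V|) is a combination of
    the products [A subset of X][A subset of V] with |A| <= D, hence of rank at
    most the number of sets of size D < k/2, again N^(1-delta).  When
    |X :&: V| < 2e and both sets are in the middle layers, V is within 6e of
    the complement of X, so each row has at most B errors, where B is the
    number of sets of size at most 6e; B is at most b^e with b polynomial in L
    (sparse_approximation).

    The alternating values force P to be large outside the interpolation
    interval, but only of size 2^D 4^e B (alternating_interpolation and
    low_degree_approximation), so the errors are about N^(1/2).  Therefore
    the error of a row in L_p is about N^(1/2) (B/N)^(1/p), and this is a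
    negative power of N once L is large because p < 2 (width_bound_exp and
    exp_beats_poly).  A general n is reduced to the least N = 4^(Le) >= n, which
    exceeds n by at most the constant factor 4^L. *)

Set Implicit Arguments.
Unset Strict Implicit.
Unset Printing Implicit Defensive.

Import Order.TTheory GRing.Theory Num.Theory.
Import numFieldNormedType.Exports.

Local Open Scope classical_set_scope.
Local Open Scope ring_scope.

(** * Kolmogorov width from a spanning family *)

Section Width.
Context (R : realType) (X : normedModType R).

Definition span_set (m : nat) (f : 'I_m -> X) : set X :=
  [set \sum_(i < m) c i *: f i | c in [set: 'I_m -> R]].

Lemma span_set_subspace m (f : 'I_m -> X) : linear_subspace (span_set f).
Proof.
split.
  by exists (fun=> 0) => //; rewrite big1// => i _; rewrite scale0r.
move=> a _ _ [c _ <-] [d _ <-]; exists (fun i => a * c i + d i) => //.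
rewrite scaler_sumr -big_split/=; apply: eq_bigr => i _.
by rewrite scalerDl scalerA.
Qed.

(** The vector with nonzero coefficient in a linear relation is redundant. *)
Lemma span_set_drop m (f : 'I_m.+1 -> X) (c : 'I_m.+1 -> R) (i : 'I_m.+1) :
  \sum_j c j *: f j = 0 -> c i != 0 ->
  span_set (f \o lift i) = span_set f.
Proof.
move=> c0 ci; apply/seteqP; split=> [_ [d _ <-]|_ [d _ <-]].
  exists (fun j => if unlift i j is Some j' then d j' else 0) => //.
  rewrite (bigD1_ord i)//= unlift_none scale0r add0r.
  by apply: eq_bigr => j _; rewrite liftK.
exists (fun j => d (lift i j) - d i / c i * c (lift i j)) => //.
have -> : \sum_j d j *: f j = \sum_j (d j - d i / c i * c j) *: f j.
  rewrite [RHS](eq_bigr (fun j => d j *: f j - (d i / c i) *: (c j *: f j))).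
    by rewrite sumrB -scaler_sumr c0 scaler0 subr0.
  by move=> j _; rewrite scalerBl scalerA.
by rewrite [RHS](bigD1_ord i)//= divfK// subrr scale0r add0r.
Qed.

Lemma span_set_basis m (f : 'I_m -> X) :
  exists k (e : 'I_k -> X), is_basis e (span_set f) /\ (k <= m)%N.
Proof.
elim: m f => [|m IH] f.
  by exists 0%N, f; split=> //; split=> // c _ i; case: i.
have [[c [c0 [i ci]]]|free] := pselect (exists c : 'I_m.+1 -> R,
    \sum_j c j *: f j = 0 /\ exists i, c i != 0).
  have [k [e [eb km]]] := IH (f \o lift i).
  by exists k, e; rewrite -(span_set_drop c0 ci); split=> //; exact: leqW.
exists m.+1, f; split=> //; split=> // c c0 i; apply/eqP.
by apply: contra_notT free => ci; exists c; split=> //; exists i.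
Qed.

(** Linearly dependent families are allowed: this is the form in which width
    bounds are used below, the dimension being the number of generators. *)
Lemma kolmogorov_width_le (I : finType) (J : pred I) (f : I -> X) (m eps : R)
    (W : set X) :
  #|J|%:R <= m ->
  (forall w, W w -> exists c : I -> R, `|w - \sum_(i in J) c i *: f i| <= eps) ->
  (kolmogorov_width m W <= eps%:E)%E.
Proof.
move=> Jm Wf; pose g := f \o (@enum_val I J).
have [k [e [eb km]]] := span_set_basis g.
apply: ge_ereal_inf; exists (ereal_sup [set dist_to x (span_set g) | x in W]).
  exists (span_set g) => //; split; first exact: span_set_subspace.
  by exists k, e; split=> //; apply: le_trans Jm; rewrite ler_nat.
apply: ge_ereal_sup => _ [w Ww <-]; have [c cw] := Wf _ Ww.
apply: ge_ereal_inf; exists `|w - \sum_(i in J) c i *: f i|%:E => //.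
exists (\sum_(i in J) c i *: f i) => //.
exists (c \o enum_val) => //; rewrite [RHS]big_enum_val. reflexivity.
Qed.

End Width.

(** * Counting small sets *)

Section SetCount.
Context (R : realType) (T : finType).
Local Open Scope nat_scope.

Definition small_sets (a : nat) : {set {set T}} := [set A : {set T} | #|A| <= a]%SET.

(** Chernoff's trick: (1 + theta)^|T| is the sum of theta^|A| over all sets A,
    and each small set contributes at least theta^a. *)
Lemma card_small_sets_le (theta : R) (a : nat) : (0 < theta <= 1)%R ->
  (#|small_sets a|%:R * theta ^+ a <= (1 + theta) ^+ #|T|)%R.
Proof.
move=> /andP[t0 t1].
have -> : ((1 + theta) ^+ #|T| = \sum_(A : {set T}) theta ^+ #|A|)%R.
  rewrite -prodr_const addrC bigA_distr; apply: eq_bigr => A _.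
  by rewrite -big_mkcond/= prodr_const.
rewrite mulr_natl -sumr_const [leRHS](bigID [in small_sets a])/=.
apply: ler_wpDr; first by apply: sumr_ge0 => A _; exact: exprn_ge0 (ltW t0).
apply: ler_sum => A; rewrite inE => Aa.
by apply: ler_wiXn2l => //; exact: ltW.
Qed.

Lemma bin_small_sets_le (a b : nat) : a <= b -> 'C(#|T|, a) <= #|small_sets b|.
Proof.
move=> ab; rewrite -card_draws; apply: subset_leq_card; apply/fintype.subsetP => A.
by rewrite !inE => /eqP->.
Qed.

End SetCount.

(** * Interpolation of alternating signs *)

Section Interpolation.
Context (R : realType).

(** The polynomial is written in the basis of binomial coefficients, in which
    the coefficients exceed 2^D only by a binomial factor.  For a = 0 they come from expanding
    (1 - 2)^j.  To move the interval from a to a+1 one needs a polynomial whose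
    value at j+1 is the opposite of the given one at j; by Pascal's rule its
    coefficients satisfy c'_i + c'_(i+1) = - c_i, an alternating tail sum, and
    the bound follows from Pascal's rule again. *)
Lemma alternating_interpolation (D a : nat) : exists c : nat -> R,
  (forall j, (a <= j <= a + D)%N ->
     \sum_(i < D.+1) c i * 'C(j, i)%:R = (-1) ^+ j) /\
  (forall i, (i <= D)%N -> `|c i| <= 2 ^+ D * 'C(D - i + a, a)%:R).
Proof.
elim: a => [|a [c [cE cb]]].
  exists (fun i => (-2) ^+ i); split=> [j /andP[_ jD]|i iD].
    rewrite [in RHS](_ : -1 = -2 + 1 :> R); last by lra.
    rewrite exprD1n (big_ord_widen D.+1 (fun i => (-2 : R) ^+ i *+ 'C(j, i)))//.
    rewrite [RHS]big_mkcond/=; apply: eq_bigr => i _.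
    rewrite mulr_natr; case: ltnP => // ji.
    by rewrite bin_small// mulr0n.
  by rewrite bin0 mulr1 normrX normrN ger0_norm// ler_weXn2l// ler1n.
pose c' i := \sum_(i <= d < D.+1) (-1) ^+ (d - i).+1 * c d.
have c'S i : (i <= D)%N -> c' i = - c i - c' i.+1.
  move=> iD; rewrite /c' big_ltn// subnn expr1 mulN1r; congr (_ + _).
  rewrite -sumrN; apply: eq_big_nat => d /andP[id _].
  rewrite (_ : (d - i = (d - i.+1).+1)%N); last by lia.
  by rewrite exprS mulN1r mulNr.
have c'0 : c' D.+1 = 0 by rewrite /c' big_geq.
exists c'; split=> [j /andP[aj jD]|i iD].
  case: j aj jD => // j aj jD.
  have -> : \sum_(i < D.+1) c' i * 'C(j.+1, i)%:R =
            \sum_(i < D.+1) (c' i + c' i.+1) * 'C(j, i)%:R.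
    under [RHS]eq_bigr do rewrite mulrDl.
    rewrite big_split/= big_ord_recl [X in _ = X + _]big_ord_recl/= !bin0 -!addrA.
    congr (_ + _); under eq_bigr do rewrite binS natrD mulrDr.
    rewrite big_split/=; congr (_ + _).
    by rewrite [RHS]big_ord_recr/= c'0 mul0r addr0.
  transitivity (\sum_(i < D.+1) - (c i * 'C(j, i)%:R)).
    apply: eq_bigr => i _; rewrite c'S; last by rewrite -ltnS.
    rewrite -mulNr; congr (_ * _).
    by rewrite subrK.
  by rewrite sumrN cE ?exprS ?mulN1r//; apply/andP; split; lia.
suff cb' m i' : (m + i' = D)%N ->
    `|c' i'| <= 2 ^+ D * 'C(m + a.+1, a.+1)%:R by apply: cb'; lia.
elim: m i' {iD} => [|m IH] {}i mE.
  rewrite add0n in mE; rewrite mE c'S// c'0 subr0 normrN.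
  by apply: le_trans (cb _ (leqnn D)) _; rewrite subnn !add0n !binn.
have iD : (i <= D)%N by lia.
rewrite c'S//; apply: le_trans (ler_normB _ _) _; rewrite normrN.
apply: le_trans (lerD (cb _ iD) (IH i.+1 _)) _; first by lia.
rewrite (_ : D - i = m.+1)%N; last by lia.
rewrite -mulrDr -natrD ler_wpM2l ?exprn_ge0// ler_nat.
by rewrite -addSnnS [in X in (_ <= X)%N]addnS binS addSnnS addnC.
Qed.

End Interpolation.

(** * Sparse approximation of characters on the cube *)

Section FiniteApproximation.
Context (R : realType) (T : finType) (l e : nat).
Context (cardT : #|T| = (2 * l.+1 * e)%N).

Local Notation B := #|small_sets T (6 * e)|.

Definition character (X V : {set T}) : R := (-1) ^+ #|X :&: V|.

(** Each i-subset of X :&: V is counted once, which turns a function of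
    |X :&: V| into a bilinear expression of low rank. *)
Lemma sum_subsets_binomial (c : nat -> R) (D : nat) (X V : {set T}) :
  \sum_(A in small_sets T D) c #|A| * (A \subset X)%:R * (A \subset V)%:R =
  \sum_(i < D.+1) c i * 'C(#|X :&: V|, i)%:R.
Proof.
rewrite (partition_big (fun A : {set T} => inord #|A| : 'I_D.+1) xpredT)//=.
apply: eq_bigr => i _; rewrite -cards_draws -sum1_card natr_sum mulr_sumr.
rewrite [LHS]big_mkcond [RHS]big_mkcond/=; apply: eq_bigr => A _.
rewrite !inE finset.subsetI -val_eqE/=; case: leqP => [AD|AD] /=.
  rewrite inordK//; case: (#|A| =P i) => [->|]; last by rewrite andbF.
  by case: (A \subset X); case: (A \subset V); rewrite /= ?(mulr0, mulr1).
rewrite (_ : (#|A| == i) = false) ?andbF//; apply/eqP => Ai.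
by move: AD (ltn_ord i); rewrite Ai; lia.
Qed.

Lemma sum_binomial_le (n j : nat) : (\sum_(i < n) 'C(j, i) <= 2 ^ j)%N.
Proof.
elim: j n => [|j IH] [|n]; rewrite ?big_ord0//.
  by rewrite big_ord_recl/= bin0 big1// => i _; rewrite bin_small.
rewrite big_ord_recl bin0; under eq_bigr do rewrite /= binS.
rewrite big_split/= addnA expnS mul2n -addnn leq_add ?IH//.
by have := IH n.+1; rewrite big_ord_recl bin0.
Qed.

(** Here L = l + 1: the polynomial has degree l e and is exact on the
    intersections of size between 2e and (l + 2)e. *)
Lemma low_degree_approximation : exists c : nat -> R, forall X V : {set T},
  let h := character X V - \sum_(A in small_sets T (l * e))
    c #|A| * (A \subset X)%:R * (A \subset V)%:R in
  ((2 * e <= #|X :&: V| <= (l + 2) * e)%N -> h = 0) /\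
  ((#|X :&: V| < 2 * e)%N -> `|h| <= 2 ^+ ((l + 2) * e) * B%:R).
Proof.
have [c [cE cb]] := alternating_interpolation R (l * e) (2 * e).
exists c => X V h; rewrite /h sum_subsets_binomial /character.
split=> [/andP[XV1 XV2]|XV].
  by rewrite cE ?subrr//; apply/andP; split; lia.
move: {h} #|X :&: V| XV => j je.
have B1 : (1 <= B)%N.
  by have := bin_small_sets_le T (leq0n (6 * e)); rewrite bin0.
have cB (i : 'I_(l * e).+1) : `|c i * 'C(j, i)%:R| <=
    2 ^+ (l * e) * B%:R * 'C(j, i)%:R.
  rewrite normrM normr_nat ler_wpM2r//; apply: le_trans (cb _ _) _.
    by have := ltn_ord i; lia.
  rewrite ler_wpM2l ?exprn_ge0// ler_nat.
  have ab : (2 * e <= 6 * e)%N by lia.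
  apply: leq_trans _ (bin_small_sets_le T ab).
  by rewrite leq_bin2l// cardT; lia.
apply: le_trans (ler_normB _ _) _; rewrite normrX normrN1 expr1n.
apply: (@le_trans _ _ (1 + 2 ^+ (l * e) * B%:R * (2 ^ j)%:R)).
  rewrite lerD2l; apply: le_trans (ler_norm_sum _ _ _) _.
  apply: le_trans (ler_sum _ (fun i _ => cB i)) _.
  rewrite -mulr_sumr ler_wpM2l ?mulr_ge0 ?exprn_ge0//.
  by rewrite -natr_sum ler_nat sum_binomial_le.
rewrite -!natrX -!natrM addrC natr1 ler_nat.
apply: (@leq_trans (2 ^ (l * e) * B * 2 ^ j.+1)).
  have : (1 <= 2 ^ (l * e) * B * 2 ^ j)%N by rewrite !muln_gt0 !expn_gt0 B1.
  by rewrite expnS; lia.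
have -> : ((l + 2) * e = l * e + 2 * e)%N by lia.
by rewrite expnD -!mulnA leq_mul2l [(B * _)%N]mulnC leq_mul2r leq_exp2l// je !orbT.
Qed.

(** V almost misses X and is almost as large as the complement of X, so the
    symmetric difference of V with that complement is small; V is recovered
    from it. *)
Lemma card_small_intersection (X : {set T}) : (l * e <= #|X|)%N ->
  (#|[set V : {set T} | (l * e <= #|V|)%N & (#|X :&: V| < 2 * e)%N]%SET|
     <= B)%N.
Proof.
move=> Xl; pose f (V : {set T}) := [set i | (i \in V) == (i \in X)]%SET.
have ff : involutive f.
  move=> V; apply/setP => i; rewrite !inE.
  by case: (i \in X); case: (i \in V).
rewrite -(card_imset _ (inv_inj ff)); apply: subset_leq_card.
apply/fintype.subsetP => _ /imsetP[V + ->]; rewrite !inE => /andP[Vl VX].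
have fE : f V = ((X :&: V) :|: ~: (X :|: V))%SET.
  by apply/setP => i; rewrite !inE; case: (i \in X); case: (i \in V).
rewrite fE; apply: leq_trans (leq_card_setU _ _) _.
have := cardsCs (X :|: V)%SET; have := cardsUI X V; have := cardsC (X :|: V)%SET.
by rewrite cardT; lia.
Qed.

Definition middle_layers : pred {set T} :=
  [pred V : {set T} | (l * e <= #|V| <= (l + 2) * e)%N].

(** Complementation exchanges the sets above and below the middle layers. *)
Lemma card_not_middle_layers :
  (#|[predC middle_layers]| <= 2 * #|small_sets T (l * e)|)%N.
Proof.
pose S := small_sets T (l * e).
have -> : (2 * #|S| = #|S| + #|[set ~: V | V in S]%SET|)%N.
  by rewrite card_imset ?mul2n -?addnn//; exact: finset.setC_inj.
apply: leq_trans _ (leq_card_setU _ _).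
apply: subset_leq_card; apply/fintype.subsetP => V.
rewrite !inE negb_and -!ltnNge => /orP[Vl|Vl]; first by rewrite ltnW.
apply/orP; right; rewrite -[V]finset.setCK imset_f// inE.
by have := cardsC V; rewrite cardT; lia.
Qed.

(** The three kinds of generators are the monomials of low degree, the
    indicators of the points outside the middle layers (there the value is
    corrected exactly) and the characters outside the middle layers. *)
Lemma sparse_approximation :
  exists (f : {set T} + {set T} + {set T} -> {set T} -> R)
    (J : pred ({set T} + {set T} + {set T})),
  (#|J| <= 5 * #|small_sets T (l * e)|)%N /\
  forall X, exists c : {set T} + {set T} + {set T} -> R,
  let h V := character X V - \sum_(i in J) c i * f i V in
  (forall V, `|h V| <= 2 ^+ ((l + 2) * e) * B%:R) /\
  (#|[set V | h V != 0%R]%SET| <= B)%N.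
Proof.
have [c0 c0P] := low_degree_approximation.
pose f (i : {set T} + {set T} + {set T}) (V : {set T}) : R := match i with
  | inl (inl A) => (A \subset V)%:R
  | inl (inr W) => (V == W)%:R
  | inr X => character X V
  end.
pose J (i : {set T} + {set T} + {set T}) := match i with
  | inl (inl A) => A \in small_sets T (l * e)
  | inl (inr W) => ~~ middle_layers W
  | inr X => ~~ middle_layers X
  end.
have sumJ (V : Type) (idx : V) (op : Monoid.law idx) (F : _ -> V) :
    \big[op/idx]_(i in J) F i =
    op (op (\big[op/idx]_(A in small_sets T (l * e)) F (inl (inl A)))
      (\big[op/idx]_(W in [predC middle_layers]) F (inl (inr W))))
    (\big[op/idx]_(X in [predC middle_layers]) F (inr X)).
  by rewrite big_sumType/= big_sumType/=.
exists f, J; split.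
  have -> : #|J| = (#|small_sets T (l * e)| + #|[predC middle_layers]| +
      #|[predC middle_layers]|)%N.
    by rewrite -!sum1_card; exact: sumJ.
  by have := card_not_middle_layers; lia.
move=> X; have [Xm|Xm] := boolP (middle_layers X); last first.
  exists (fun i : {set T} + {set T} + {set T} => match i with inr Y => (Y == X)%:R | _ => 0 end) => h.
  have h0 V : h V = 0.
    rewrite /h sumJ/= big1 ?add0r; last by move=> *; rewrite mul0r.
    rewrite big1 ?add0r; last by move=> *; rewrite mul0r.
    rewrite (bigD1 X)//= eqxx mul1r big1 ?addr0 ?subrr//.
    by move=> Y /andP[_ /negPf ->]; rewrite mul0r.
  split=> [V|]; first by rewrite h0 normr0 mulr_ge0 ?exprn_ge0.
  rewrite (_ : [set V | _]%SET = finset.set0) ?cards0//.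
  by apply/setP => V; rewrite !inE h0 eqxx.
pose h0 V := character X V - \sum_(A in small_sets T (l * e))
    c0 #|A| * (A \subset X)%:R * (A \subset V)%:R.
exists (fun i : {set T} + {set T} + {set T} => match i with
  | inl (inl A) => c0 #|A| * (A \subset X)%:R
  | inl (inr W) => h0 W
  | inr _ => 0 end) => h.
have hE V : h V = if middle_layers V then h0 V else 0.
  rewrite /h sumJ/= [X in _ - (_ + _ + X)]big1 ?addr0; last first.
    by move=> *; rewrite mul0r.
  rewrite opprD addrA -/(h0 V); case: ifPn => Vm.
    rewrite big1 ?subr0// => W Wm; rewrite (_ : (V == W) = false) ?mulr0//.
    by apply/eqP => VW; have /negP[] : ~~ middle_layers W := Wm; rewrite -VW.
  rewrite (bigD1 V)//= eqxx mulr1 big1 ?addr0 ?subrr// => W /andP[_ WV].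
  by rewrite eq_sym (negPf WV) mulr0.
have XVl V : (#|X :&: V| <= (l + 2) * e)%N.
  move: Xm => /andP[_]; apply: leq_trans.
  exact/subset_leq_card/finset.subsetIl.
have B0 : 0 <= 2 ^+ ((l + 2) * e) * B%:R :> R by rewrite mulr_ge0 ?exprn_ge0.
split=> [V|].
  rewrite hE; case: ifPn => _; last by rewrite normr0.
  have [h00 h0b] := c0P X V; have [XV|XV] := leqP (2 * e) #|X :&: V|.
    by rewrite /h0 h00 ?normr0// XV XVl.
  exact: h0b.
have /andP[Xl _] := Xm.
apply: leq_trans _ (card_small_intersection Xl); apply: subset_leq_card.
apply/fintype.subsetP => V; rewrite !inE hE; case: ifPn; last by rewrite eqxx.
move=> /andP[-> _] /=; apply: contraNT; rewrite -leqNgt => XV.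
by rewrite /h0 (c0P X V).1 // XV XVl.
Qed.

End FiniteApproximation.

(** * Binary digits and Lebesgue measure *)

Section Digits.
Context (R : realType) (k : nat).
Local Notation mu := (@leb01 R).

Definition digits (t : R) : {set 'I_k} :=
  [set i : 'I_k | binary_digit i.+1 t]%SET.

(** Written through Rademacher functions, the indicator of a cylinder is
    measurable because they are. *)
Lemma digits_eqE (V : {set 'I_k}) (t : R) : (digits t == V)%:R =
  \prod_(i < k) ((1 + (-1) ^+ (i \in V) * rademacher i.+1 t) / 2) :> R.
Proof.
have [<-|/eqP tV] := eqVneq (digits t) V.
  rewrite big1// => i _; rewrite inE /rademacher.
  by case: (binary_digit _ _); rewrite ?expr0 ?expr1; lra.
have [i iV] : exists i, (i \in digits t) != (i \in V).
  apply/existsP; apply: contraT; rewrite negb_exists => /forallP tV0.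
  by exfalso; apply: tV; apply/setP => i; apply/eqP; rewrite -[_ == _]negbK.
rewrite (bigD1 i)//= [X in X * _](_ : _ = 0) ?mul0r//.
move: iV; rewrite inE /rademacher.
by case: (binary_digit _ _); case: (i \in V); rewrite ?expr0 ?expr1//; lra.
Qed.

Lemma measurable_digits_eq V :
  measurable_fun [set: R] (fun t => (digits t == V)%:R : R).
Proof.
under eq_fun do rewrite digits_eqE.
apply: measurable_prod => i _ /=; apply: measurable_funM => //.
apply: measurable_funD => //; apply: measurable_funM => //.
exact: measurable_rademacher.
Qed.

Lemma digits_sumE (g : {set 'I_k} -> R) t :
  g (digits t) = \sum_V g V * (digits t == V)%:R.
Proof.
rewrite (bigD1 (digits t))//= eqxx mulr1 big1 ?addr0// => V /negPf.
by rewrite eq_sym => ->; rewrite mulr0.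
Qed.

Lemma measurable_digits (g : {set 'I_k} -> R) :
  measurable_fun [set: R] (g \o digits).
Proof.
rewrite (_ : _ \o _ = fun t => \sum_V g V * (digits t == V)%:R); last first.
  by apply/funext => t; exact: digits_sumE.
apply: measurable_sum => V; apply: measurable_funM => //.
exact: measurable_digits_eq.
Qed.

Definition cylinder (V : {set 'I_k}) : set R := [set t | digits t = V].

Lemma indic_cylinder V t : \1_(cylinder V) t = (digits t == V)%:R :> R.
Proof.
by rewrite indicE; congr (_%:R); congr (nat_of_bool _); apply/idP/eqP; rewrite inE.
Qed.

Lemma measurable_cylinder V : measurable (cylinder V : set (measurableTypeR R)).
Proof.
apply/(measurable_indicP R).
rewrite (_ : \1_(cylinder V) = (fun t => (digits t == V)%:R)).
  exact: measurable_digits_eq.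
by apply/funext => t; exact: indic_cylinder.
Qed.

Lemma truncn_double (y : R) : 0 <= y ->
  Num.truncn (2 * y) = (odd (Num.truncn (2 * y)) + (Num.truncn y).*2)%N.
Proof.
move=> y0; rewrite -[LHS]odd_double_half; congr (_ + _.*2)%N.
apply/esym/eqP; rewrite truncn_eq//.
have /truncn_itv : 0 <= 2 * y by rewrite mulr_ge0.
move: (Num.truncn _) => n; rewrite -[n.+1%:R]natr1 -[n./2.+1%:R]natr1.
have -> : n%:R = (odd n)%:R + 2 * n./2%:R :> R.
  by rewrite -[in LHS](odd_double_half n) natrD -mul2n natrM.
have o0 : 0 <= (odd n)%:R :> R by exact: ler0n.
have o1 : (odd n)%:R <= 1 :> R by rewrite (ler_nat R _ 1) leq_b1.
by move: (odd n)%:R (n./2%:R) o0 o1 => a b; lra.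
Qed.

(** The first k digits of t determine the integral part of 2^k t, since
    doubling appends one digit. *)
Lemma truncn_digits_inj (s t : R) : 0 <= s < 1 -> 0 <= t < 1 ->
  digits s = digits t -> Num.truncn (2 ^+ k * s) = Num.truncn (2 ^+ k * t).
Proof.
move=> /andP[s0 s1] /andP[t0 t1] st.
have : forall j, (j <= k)%N ->
    Num.truncn (2 ^+ j * s) = Num.truncn (2 ^+ j * t); last exact.
elim=> [_|j IH jk].
  by rewrite !mul1r !(truncn_def (n := 0))// ?s0 ?t0.
have /setP/(_ (Ordinal jk)) := st; rewrite !inE /binary_digit /= => odd_st.
rewrite !exprS -!mulrA truncn_double ?mulr_ge0 ?exprn_ge0//.
rewrite [RHS]truncn_double ?mulr_ge0 ?exprn_ge0//.
by rewrite IH ?(ltnW jk)// !mulrA -!exprS odd_st.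
Qed.

(** In [0, 1[ a cylinder lies in one dyadic interval of length 2^-k; the point
    1, all of whose digits are 0, is negligible. *)
Lemma leb01_cylinder V : (mu (cylinder V) <= (2 ^- k)%:E)%E.
Proof.
have [[t0 [t01 t0V]]|no] := pselect (exists t0, 0 <= t0 < 1 /\ digits t0 = V).
  pose m : R := (Num.truncn (2 ^+ k * t0))%:R.
  have k0 : 0 < 2 ^+ k :> R by rewrite exprn_gt0.
  have mm : measurable (`[m / 2 ^+ k, (m + 1) / 2 ^+ k] : set (measurableTypeR R)).
    exact: measurable_itv.
  apply: (@le_trans _ _ (@lebesgue_measure R (`[m / 2 ^+ k, (m + 1) / 2 ^+ k] `|` [set 1]))).
    apply: le_measure; rewrite ?inE.
    - by apply: measurableI; [exact: measurable_cylinder|exact: measurable_itv].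
    - by apply: measurableU => //; exact: measurable_set1.
    move=> t [tV]; rewrite /= in_itv/= => /andP[t_ge0].
    rewrite le_eqVlt => /orP[/eqP->|t1]; first by right.
    left; rewrite /= in_itv/= ler_pdivrMr// ler_pdivlMr// mulrC.
    have kt : 0 <= 2 ^+ k * t by rewrite mulr_ge0// ltW.
    rewrite /m (truncn_digits_inj t01 _ (etrans t0V (esym tV))) ?t_ge0//.
    by have /andP[-> /ltW] := truncn_itv kt; rewrite natr1.
  apply: (le_trans (measureU2 _ mm (measurable_set1 _))).
  rewrite -[leRHS]adde0; apply: leeD; last by rewrite [leLHS]lebesgue_measure_set1.
  have := @lebesgue_measure_itv R `[m / 2 ^+ k, (m + 1) / 2 ^+ k].
  rewrite /= lte_fin ltr_pM2r ?invr_gt0// ltrDl ltr01 -EFinB => ->.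
  by rewrite lee_fin -mulrBl addrAC subrr add0r mul1r.
apply: (@le_trans _ _ (@lebesgue_measure R [set 1])).
  apply: le_measure; rewrite ?inE.
  - by apply: measurableI; [exact: measurable_cylinder|exact: measurable_itv].
  - exact: measurable_set1.
  move=> t [tV]; rewrite /= in_itv/= => /andP[t_ge0].
  rewrite le_eqVlt => /orP[/eqP->//|t1].
  by exfalso; apply: no; exists t; rewrite t_ge0.
by rewrite [leLHS]lebesgue_measure_set1 lee_fin invr_ge0 exprn_ge0.
Qed.

Lemma integral_digits (g : {set 'I_k} -> R) : (forall V, 0 <= g V) ->
  (\int[mu]_t (g (digits t))%:E = \sum_V (g V)%:E * mu (cylinder V))%E.
Proof.
move=> g0.
under eq_integral do rewrite digits_sumE -sumEFin.
rewrite ge0_integral_sum//=.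
- apply: eq_bigr => V _; under eq_integral do rewrite EFinM -indic_cylinder.
  rewrite ge0_integralZl ?lee_fin//.
  + by rewrite integral_indic ?setIT//; exact: measurable_cylinder.
  + apply/measurable_EFinP/measurable_indic; exact: measurable_cylinder.
- move=> V; apply/measurable_EFinP; apply: measurable_funM => //.
  exact: measurable_digits_eq.
- by move=> V t _; rewrite lee_fin mulr_ge0.
Qed.

End Digits.

(** * Functions of the digits in L_p *)

Section DigitLp.
Context (R : realType) (p : R) (p1 : 1 <= p) (k : nat).
Local Notation mu := (@leb01 R).

Let p_gt0 : 0 < p. Proof. exact: lt_le_trans p1. Qed.

Lemma Lnorm_digits (g : {set 'I_k} -> R) :
  ('N[mu]_p%:E[EFin \o (g \o @digits R k)] =
   (\sum_V (`|g V| `^ p)%:E * mu (cylinder V)) `^ p^-1)%E.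
Proof.
rewrite unlock /Lnorm; congr (_ `^ _)%E.
rewrite -integral_digits; last by move=> V; exact: powR_ge0.
by apply: eq_integral => t _ /=.
Qed.

Lemma Lnorm_digits_le (g : {set 'I_k} -> R) (M : R) (b : nat) :
  (forall V, `|g V| <= M) -> (#|[set V | g V != 0%R]%SET| <= b)%N ->
  ('N[mu]_p%:E[EFin \o (g \o @digits R k)] <=
     (M * (b%:R / 2 ^+ k) `^ p^-1)%:E)%E.
Proof.
move=> gM gb; have M0 : 0 <= M := le_trans (normr_ge0 _) (gM finset.set0).
have bk0 : 0 <= b%:R / 2 ^+ k :> R by rewrite mulr_ge0// invr_ge0 exprn_ge0.
have -> : M * (b%:R / 2 ^+ k) `^ p^-1 = (M `^ p * (b%:R / 2 ^+ k)) `^ p^-1.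
  by rewrite powRM ?powR_ge0// -powRrM mulfV ?gt_eqF// powRr1.
rewrite Lnorm_digits -poweR_EFin gt0_ler_poweR ?in_itv/= ?leey ?andbT//.
- by rewrite invr_ge0 ltW.
- by apply: sume_ge0 => V _; rewrite mule_ge0// lee_fin powR_ge0.
- by rewrite lee_fin mulr_ge0// powR_ge0.
apply: (@le_trans _ _
    (\sum_(V in [set V | g V != 0%R]%SET) (M `^ p * 2 ^- k)%:E)%E).
  rewrite [leRHS]big_mkcond/=; apply: lee_sum => V _; rewrite inE.
  have [->|gV] := eqVneq (g V) 0.
    by rewrite normr0 powR0 ?gt_eqF// mul0e.
  rewrite EFinM lee_pmul ?lee_fin ?powR_ge0//; last exact: leb01_cylinder.
  by rewrite ge0_ler_powR ?nnegrE// ltW.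
rewrite sumEFin lee_fin sumr_const -[leLHS]mulr_natr -mulrA ler_wpM2l ?powR_ge0//.
by rewrite mulrC ler_wpM2r ?invr_ge0 ?exprn_ge0// ler_nat.
Qed.

Lemma digits_Lfun (g : {set 'I_k} -> R) :
  (g \o @digits R k : measurableTypeR R -> R) \in Lfun mu p%:E.
Proof.
apply/andP; split; rewrite inE; first exact: measurable_digits.
rewrite /= /finite_norm.
pose M := \sum_V `|g V|.
have gM V : `|g V| <= M by rewrite /M (bigD1 V)//= lerDl sumr_ge0.
exact: le_lt_trans (Lnorm_digits_le gM (leqnn _)) (ltry _).
Qed.

Definition digit_Lp (g : {set 'I_k} -> R) : L01 p1 :=
  Lp_class (Lfun_Sub (lee1_EFin p1) (digits_Lfun g)).

Lemma digit_LpD g h : digit_Lp (fun V => g V + h V) = digit_Lp g + digit_Lp h.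
Proof. by rewrite -Lp_classD; apply/Lp_classP; apply: filterE. Qed.

Lemma digit_LpZ a g : digit_Lp (fun V => a * g V) = a *: digit_Lp g.
Proof.
rewrite -[RHS]/(Lp_scale _ _) -Lp_classZ; apply/Lp_classP.
by apply: filterE.
Qed.

Lemma eq_digit_Lp g h : g =1 h -> digit_Lp g = digit_Lp h.
Proof. by move=> /funext ->. Qed.

Lemma digit_Lp_sum (I : Type) (s : seq I) (P : pred I) (c : I -> R)
    (f : I -> {set 'I_k} -> R) :
  digit_Lp (fun V => \sum_(i <- s | P i) c i * f i V) =
  \sum_(i <- s | P i) c i *: digit_Lp (f i).
Proof.
elim: s => [|i s IH].
  rewrite big_nil -(scale0r (digit_Lp (fun=> 0))) -digit_LpZ.
  by apply: eq_digit_Lp => V; rewrite big_nil mul0r.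
rewrite big_cons -IH; case: ifPn => Pi.
  rewrite -digit_LpZ -digit_LpD; apply: eq_digit_Lp => V.
  by rewrite big_cons Pi.
by apply: eq_digit_Lp => V; rewrite big_cons (negPf Pi).
Qed.

Lemma digit_LpB g h : digit_Lp (fun V => g V - h V) = digit_Lp g - digit_Lp h.
Proof.
rewrite -scaleN1r -digit_LpZ -digit_LpD; apply: eq_digit_Lp => V.
by rewrite mulN1r.
Qed.

Lemma norm_digit_Lp_le (g : {set 'I_k} -> R) (M : R) (b : nat) :
  (forall V, `|g V| <= M) -> (#|[set V | g V != 0%R]%SET| <= b)%N ->
  `|digit_Lp g| <= M * (b%:R / 2 ^+ k) `^ p^-1.
Proof.
move=> gM gb; rewrite Lp_normE -lee_fin fineK; first exact: Lnorm_digits_le.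
by rewrite ge0_fin_numE ?Lnorm_ge0// (le_lt_trans (Lnorm_digits_le gM gb)) ?ltry.
Qed.

Definition bits (x : nat) : {set 'I_k} := [set i : 'I_k | odd (x %/ 2 ^ i)]%SET.

Lemma walshE n (t : R) : (n.-1 < 2 ^ k)%N ->
  walsh n t = character R (bits n.-1) (digits k t).
Proof.
move=> nk; pose F i : R := rademacher i.+1 t ^+ odd (n.-1 %/ 2 ^ i).
have widen m : (n.-1 < 2 ^ m)%N -> forall m', (m <= m')%N ->
    \prod_(i < m) F i = \prod_(i < m') F i.
  move=> nm m' mm'; rewrite (big_ord_widen m' F)// big_mkcond/=.
  apply: eq_bigr => i _; case: ltnP => // mi; rewrite /F divn_small ?expr0//.
  by apply: leq_trans nm _; rewrite leq_exp2l.
have nn : (n.-1 < 2 ^ n)%N by exact: leq_ltn_trans (leq_pred n) (ltn_expl _ _).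
rewrite /walsh (widen _ nn (n + k)%N) ?leq_addr//.
rewrite -(widen _ nk) ?leq_addl// /character -prodr_const [RHS]big_mkcond/=.
apply: eq_bigr => i _; rewrite !inE /F /rademacher.
by case: odd; case: binary_digit; rewrite ?expr0 ?expr1 ?expr1n.
Qed.

Lemma walsh_L01E n : (n.-1 < 2 ^ k)%N ->
  walsh_L01 p1 n = digit_Lp (character R (bits n.-1)).
Proof.
move=> nk; apply/Lp_classP; apply: filterE => t _.
exact: walshE.
Qed.

(** The map digit_Lp carries the sparse approximation over to L_p. *)
Lemma kolmogorov_width_walsh_le (l e n : nat) (m : R) :
  k = (2 * l.+1 * e)%N -> (n <= 2 ^ k)%N ->
  5 * #|small_sets 'I_k (l * e)|%:R <= m ->
  (@kolmogorov_width R (L01 p1) m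
     [set walsh_L01 p1 j | j in [set j : nat | (1 <= j <= n)%N]] <=
   (2 ^+ ((l + 2) * e) * #|small_sets 'I_k (6 * e)|%:R *
     (#|small_sets 'I_k (6 * e)|%:R / 2 ^+ k) `^ p^-1)%:E)%E.
Proof.
move=> kE nk small_m.
have cardk : #|'I_k| = (2 * l.+1 * e)%N by rewrite card_ord.
have [f [J [cardJ fJ]]] := sparse_approximation R cardk.
apply: (@kolmogorov_width_le _ _ _ J (digit_Lp \o f)).
  by apply: le_trans small_m; rewrite -natrM ler_nat.
move=> _ [j /= /andP[j1 jn] <-]; have [c [hM hB]] := fJ (bits j.-1).
exists c; rewrite walsh_L01E -?digit_Lp_sum -?digit_LpB; last first.
  by apply: leq_trans nk; rewrite prednK.
exact: norm_digit_Lp_le hB.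
Qed.

End DigitLp.

(** * Choice of the parameters *)

Section ConstantEstimates.
Context (R : realType).

(** The Chernoff bound with theta = 1/L, where (1 + 1/L)^(2L) <= exp 2: the
    base is only polynomial in L = l + 1. *)
Lemma card_small_sets_six_le (T : finType) (l e : nat) :
  #|T| = (2 * l.+1 * e)%N ->
  #|small_sets T (6 * e)|%:R <= (l.+1%:R ^+ 6 * expR 2) ^+ e :> R.
Proof.
move=> cardT; have L0 : 0 < l.+1%:R :> R by rewrite ltr0n.
have theta01 : 0 < (l.+1%:R^-1 : R) <= 1.
  by rewrite invr_gt0 L0 invf_le1// ler1n.
have := @card_small_sets_le R T _ (6 * e) theta01.
rewrite exprVn ler_pdivrMr ?exprn_gt0// => /le_trans; apply.
rewrite exprMn -exprM mulrC ler_wpM2l ?exprn_ge0//.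
apply: (@le_trans _ _ (expR l.+1%:R^-1 ^+ #|T|)).
  by apply: lerXn2r; rewrite ?nnegrE ?expR_ge0 ?addr_ge0 ?invr_ge0// expR_ge1Dx.
rewrite -!expRM_natl cardT !natrM [X in expR X](_ : _ = e%:R * 2)//.
by field; rewrite gt_eqF.
Qed.

(** The Chernoff bound with theta = 1 - 1/L, L = l + 1.  Since
    (1 + theta)^2 = 4 theta (1 + 1/(4lL)), the e-th root of the bound is at most
    4^L theta exp(1/(4l)), and theta <= exp(-1/L) beats exp(1/(4l)). *)
Lemma card_small_sets_below_half (l : nat) : (0 < l)%N ->
  exists2 rho : R, 0 < rho < 1 & forall (T : finType) (e : nat),
    #|T| = (2 * l.+1 * e)%N ->
    #|small_sets T (l * e)|%:R <= (rho * 4 ^+ l.+1) ^+ e.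
Proof.
move=> l0; set L : R := l.+1%:R; set l' : R := l%:R.
have LE : L = l' + 1 by rewrite /L -natr1.
have l'1 : 1 <= l' by rewrite ler1n.
have L0 : 0 < L by lra.
pose theta := l' / L.
have theta0 : 0 < theta by rewrite divr_gt0//; lra.
have theta1 : theta <= 1 by rewrite ler_pdivrMr//; lra.
exists (expR (- L^-1 + (4 * l')^-1)).
  rewrite expR_gt0 expR_lt1 addrC subr_lt0 ltf_pV2 ?posrE//; lra.
move=> T e cardT.
have theta01 : 0 < theta <= 1 by rewrite theta0.
have := @card_small_sets_le R T _ (l * e) theta01.
rewrite -ler_pdivlMr ?exprn_gt0// => /le_trans; apply.
rewrite cardT !exprM -expr_div_n; apply: lerXn2r.
- by rewrite nnegrE divr_ge0 ?exprn_ge0//; lra.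
- by rewrite nnegrE mulr_ge0 ?expR_ge0 ?exprn_ge0.
rewrite ler_pdivrMr ?exprn_gt0//.
have -> : (1 + theta) ^+ 2 = 4 * theta * (1 + (4 * l' * L)^-1).
  by rewrite /theta LE; field; apply/andP; split; lra.
have thetaE : theta <= expR (- L^-1).
  apply: le_trans (expR_ge1Dx _).
  by rewrite /theta LE le_eqVlt; apply/orP; left; apply/eqP; field; lra.
have powE : (1 + (4 * l' * L)^-1) ^+ l.+1 <= expR (4 * l')^-1.
  apply: (@le_trans _ _ (expR (4 * l' * L)^-1 ^+ l.+1)).
    have c0 : 0 <= (4 * l' * L)^-1 by rewrite invr_ge0 !mulr_ge0//; lra.
    by apply: lerXn2r; rewrite ?nnegrE ?expR_ge0 ?addr_ge0// expR_ge1Dx.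
  rewrite -expRM_natl -/L [X in expR X](_ : _ = (4 * l')^-1)//.
  by field; apply/andP; split; lra.
clearbody theta; rewrite !exprMn [theta ^+ l.+1]exprSr expRD.
have swap (x y z w : R) : x * (z * w) * y = w * y * (x * z) by ring.
rewrite swap.
have theta0' := ltW theta0; rewrite -[leRHS]mulrA.
rewrite ler_wpM2r ?mulr_ge0 ?exprn_ge0//.
apply: ler_pM => //.
rewrite exprn_ge0// addr_ge0// invr_ge0 !mulr_ge0//; lra.
Qed.

(** The left-hand side is the base q of the error bound in width_bound_exp,
    with kappa = (2/p - 1) ln 2. *)
Lemma exp_beats_poly (kappa : R) : 0 < kappa -> exists2 l : nat, (0 < l)%N &
  2 * (l.+1%:R ^+ 6 * expR 2) ^+ 2 * expR (- (kappa * l.+1%:R)) < 1.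
Proof.
move=> kappa0.
(* The power 13 exceeds by one the degree 12 of the polynomial factor; 13! is
   kept abstract so that it is never computed. *)
have [F F0 expF] : exists2 F : R, 0 < F & forall x, 0 <= x -> x ^+ 13 / F < expR x.
  exists 13`!%:R => [|x x0]; first by rewrite ltr0n fact_gt0.
  by apply: lt_le_trans (expR_ge1Dxn 12 x0); rewrite ltrDr.
pose K : R := 2 * expR 2 ^+ 2 * F / kappa ^+ 13.
exists (Num.truncn K).+1 => //; set l := (Num.truncn K).+1.
have Kl : K < l.+1%:R.
  by apply: lt_trans (truncnS_gt K) _; rewrite ltr_nat.
have L0 : 0 < l.+1%:R :> R by rewrite ltr0n.
rewrite expRN ltr_pdivrMr ?expR_gt0// mul1r.
apply: lt_trans (expF _ (ltW (mulr_gt0 kappa0 L0))).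
rewrite ltr_pdivlMr// exprMn; move: Kl; rewrite /K ltr_pdivrMr ?exprn_gt0//.
rewrite -(ltr_pM2r (exprn_gt0 12 L0)); congr (_ < _); ring.
Qed.

End ConstantEstimates.

(** * The width of the Walsh system *)

Lemma pow2_expR (R : realType) (k : nat) : 2 ^+ k = expR (k%:R * ln 2) :> R.
Proof. by rewrite expRM_natl lnK// posrE. Qed.

(** With L = l + 1, the powers of 2 combine to
    2^(L+1) 4^(-L/p) = 2 exp(- (2/p - 1) L ln 2) per unit of e, and the two
    occurrences of B cost a factor b^2, as B^(1/p) <= b^e. *)
Lemma width_bound_exp (R : realType) (p : R) (l e : nat) (B : R) :
  1 <= p -> 0 <= B <= (l.+1%:R ^+ 6 * expR 2) ^+ e ->
  2 ^+ ((l + 2) * e) * B * (B / 2 ^+ (2 * l.+1 * e)) `^ p^-1 <=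
  (2 * (l.+1%:R ^+ 6 * expR 2) ^+ 2 *
     expR (- (ln 2 * (2 / p - 1) * l.+1%:R))) ^+ e.
Proof.
move=> p1; set b := l.+1%:R ^+ 6 * expR 2 => /andP[B0 Bb].
have p0 : 0 < p by exact: lt_le_trans p1.
have b1 : 1 <= b.
  rewrite /b -[leLHS]mul1r ler_pM//.
    by rewrite exprn_ege1// ler1n.
  by apply: le_trans (expR_ge1Dx 2); lra.
have be1 : 1 <= b ^+ e by exact: exprn_ege1.
have be0 : 0 <= b ^+ e by exact: le_trans be1.
have Bp : B `^ p^-1 <= b ^+ e.
  apply: (@le_trans _ _ ((b ^+ e) `^ p^-1)).
    by rewrite ge0_ler_powR ?nnegrE// ltW// invr_gt0.
  by rewrite -[leRHS]powRr1// ler_powR// invf_le1.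
rewrite powRM// ?invr_ge0 ?exprn_ge0//.
have -> : (2 ^- (2 * l.+1 * e)) `^ p^-1 =
    expR (- (l.+1%:R * ln 2 * (2 / p))) ^+ e.
  rewrite pow2_expR -expRN -expRM -expRM_natl; congr expR.
  by rewrite !natrM; field; rewrite gt_eqF.
have -> : 2 ^+ ((l + 2) * e) = (2 * expR (l.+1%:R * ln 2)) ^+ e :> R.
  by rewrite -pow2_expR -exprS exprM addn2.
have -> : (2 * b ^+ 2 * expR (- (ln 2 * (2 / p - 1) * l.+1%:R))) ^+ e =
    (2 * expR (l.+1%:R * ln 2)) ^+ e * b ^+ e *
    (b ^+ e * expR (- (l.+1%:R * ln 2 * (2 / p))) ^+ e).
  rewrite -!exprMn; congr (_ ^+ e).
  have -> : - (ln 2 * (2 / p - 1) * l.+1%:R) =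
    l.+1%:R * ln 2 + - (l.+1%:R * ln 2 * (2 / p)) by ring.
  by rewrite expRD; ring.
by rewrite ler_pM ?mulr_ge0 ?exprn_ge0 ?powR_ge0 ?expR_ge0// ?ler_wpM2l
  ?ler_wpM2r ?mulr_ge0 ?exprn_ge0 ?expR_ge0.
Qed.

Theorem theorem1 (R : realType) (p : R) (p1 : 1 <= p) (p2 : p < 2) :
  exists2 delta : R, 0 < delta &
    \forall n \near \oo,
      (@kolmogorov_width R (L01 p1) (n%:R `^ (1 - delta))
         [set walsh_L01 p1 k | k in [set k : nat | (1 <= k <= n)%N]]
       <= (n%:R `^ (- delta))%:E)%E.
Proof.
have ln2 : 0 < ln 2 :> R by rewrite ln_gt0// ltr1n.
have kappa0 : 0 < ln 2 * (2 / p - 1).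
  by rewrite mulr_gt0// subr_gt0 ltr_pdivlMr ?mul1r//; exact: lt_le_trans p1.
have [l l0 q1] := exp_beats_poly kappa0.
have [rho /andP[rho0 rho1] small_half] := card_small_sets_below_half R l0.
set q := 2 * _ * _ in q1.
have q0 : 0 < q.
  by rewrite !mulr_gt0 ?expR_gt0// exprn_gt0// mulr_gt0 ?expR_gt0// exprn_gt0.
(* The factor exp(-omega) is gained twice per unit of e: one copy yields
   n^(-delta), the other absorbs the constants 5 and 4^L. *)
have [omega omega0 [rho_le q_le]] : exists2 omega : R, 0 < omega &
    rho <= expR (- omega) ^+ 2 /\ q <= expR (- omega) ^+ 2.
  exists (- ln (Num.max rho q) / 2).
    by rewrite divr_gt0// oppr_gt0 ln_lt0// lt_max rho0 gt_max rho1 q1.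
  have -> : expR (- (- ln (Num.max rho q) / 2)) ^+ 2 = Num.max rho q.
    rewrite -expRM_natl [X in expR X](_ : _ = ln (Num.max rho q)); last by field.
    by rewrite lnK// posrE lt_max rho0.
  by rewrite !le_max !lexx orbT.
pose N := (4 ^ l.+1)%N; have N1 : (1 < N)%N by rewrite /N expnS; have := expn_gt0 4 l; lia.
pose c := ln N%:R : R.
have c0 : 0 < c by rewrite ln_gt0// ltr1n.
(* Since n <= N^e with ln N = c, this delta gives n^(-delta) >= exp(-omega)^e. *)
exists (omega / c); first by rewrite divr_gt0.
have [E0 E0P] : exists E0 : nat, 5 * N%:R <= omega * E0%:R.
  exists (Num.truncn (5 * N%:R / omega)).+1; rewrite [leRHS]mulrC -ler_pdivrMr//.
  by rewrite ltW// truncnS_gt.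
exists (N ^ E0.+1)%N => // n /= nN.
have n1 : (1 < n)%N by apply: leq_trans nN; rewrite -(exp1n E0.+1) ltn_exp2r.
have n0 : 0 < n%:R :> R by rewrite ltr0n ltnW.
pose e := up_log N n.
have /andP[en ne] := up_log_bounds N1 n1; rewrite -/e in en ne.
have E0e : (E0 < e)%N.
  by rewrite -(leq_exp2l _ _ N1) (leq_trans nN).
have nE : n%:R `^ (- (omega / c)) >= expR (- omega) ^+ e.
  rewrite -[n%:R]lnK ?posrE// -expRM -expRM_natl ler_expR.
  have : ln n%:R <= e%:R * c.
    rewrite /c mulr_natl -lnXn ?ltr0n ?(ltnW N1)//.
    by rewrite ler_ln ?posrE ?exprn_gt0 ?ltr0n ?(ltnW N1) ?(ltnW n1)// -natrX ler_nat.
  rewrite mulrN mulrN lerN2 => lnn.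
  by rewrite mulrCA [leRHS]mulrC ler_pM2l// ler_pdivrMr.
set m := expR (- omega) ^+ e in nE.
have m0 : 0 <= m by rewrite exprn_ge0 ?expR_ge0.
have m1 : m <= 1.
  by rewrite exprn_ile1 ?expR_ge0// expR_le1 oppr_le0 ltW.
have Nm : 5 * N%:R * m <= 1.
  rewrite /m -expRM_natl mulrN expRN ler_pdivrMr ?expR_gt0// mul1r.
  apply: le_trans E0P _; apply: le_trans (expR_ge1Dx _).
  rewrite [leLHS]mulrC -[leLHS]add0r lerD// ler_wpM2r ?ler_nat ?(ltnW E0e)//.
  exact: ltW.
have sqE : (expR (- omega) ^+ 2) ^+ e = m * m by rewrite /m -expr2 exprAC.
have kE : (2 ^ (2 * l.+1 * e) = N ^ e)%N by rewrite -mulnA expnM [LHS]expnM.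
apply: le_trans (kolmogorov_width_walsh_le p1 (e := e) (l := l) _ _ _) _.
- exact: erefl.
- by rewrite kE.
- have cardk : #|'I_(2 * l.+1 * e)| = (2 * l.+1 * e)%N by rewrite card_ord.
  have Ne : N%:R ^+ e <= N%:R * n%:R :> R.
    rewrite -natrX -natrM ler_nat -(ltn_predK E0e) expnS leq_mul2l.
    by rewrite (ltnW en) orbT.
  apply: (@le_trans _ _ (5 * (expR (- omega) ^+ 2 * 4 ^+ l.+1) ^+ e)).
    rewrite ler_wpM2l//; apply: le_trans (small_half _ _ cardk) _.
    apply: lerXn2r; rewrite ?nnegrE ?mulr_ge0 ?exprn_ge0 ?expR_ge0//.
      exact: ltW.
    by rewrite ler_wpM2r// exprn_ge0.
  rewrite powRD; last by apply/implyP => _; rewrite gt_eqF.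
  rewrite powRr1 ?ler0n//.
  apply: le_trans _ (ler_wpM2l (ltW n0) nE).
  have -> : 4 ^+ l.+1 = N%:R :> R by rewrite /N natrX.
  rewrite exprMn sqE.
  apply: (@le_trans _ _ (5 * N%:R * m * (n%:R * m))).
    have -> : 5 * N%:R * m * (n%:R * m) = 5 * (m * m * (N%:R * n%:R)) by ring.
    by rewrite ler_wpM2l// ler_wpM2l// mulr_ge0.
  by rewrite -[leRHS]mul1r ler_wpM2r// mulr_ge0// ltW.
rewrite lee_fin; apply: le_trans (width_bound_exp p1 _) _.
  rewrite ler0n card_small_sets_six_le//; exact: card_ord.
rewrite -/q; apply: le_trans _ nE; apply: (@le_trans _ _ (m * m)).
  by rewrite -sqE; apply: lerXn2r; rewrite ?nnegrE ?exprn_ge0 ?expR_ge0// ltW.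
by rewrite -[leRHS]mulr1 ler_wpM2l.
Qed.
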